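(* Let $A\in\mathcal{H}_\alpha(\mathbb{R}^{\mathbb{N}})$. The family of maps $K_n : \mathcal{B}\times \mathbb{R}^{\mathbb{N}} \to [0, 1]$, $n \in \mathbb{N}$, defined by $K_n(E, y) = \mu^y_n(E)$, is a Gibbsian specification; that is: (a) The map $y \mapsto K_n(E, y)$ is $\sigma^n\mathcal{B}$-measurable for any $E \in \mathcal{B}$. (b) The map $E \mapsto K_n(E, y)$ is a probability measure for each $y \in \mathbb{R}^{\mathbb{N}}$. (c) For any $n \in \mathbb{N}$, $r \in \mathbb{N} \cup \{0\}$, any $\alpha$-Hölder continuous function $\varphi : \mathbb{R}^{\mathbb{N}} \to \mathbb{R}$ and any $z\in\mathbb{R}^{\mathbb{N}}$, the compatibility condition $$K_{n+r}(\varphi, z) = K_{n+r}(K_n(\varphi, \cdot), z)$$ holds, where $K_n(\varphi, y) = \int_{\mathbb{R}^{\mathbb{N}}}\varphi \, d\mu^y_n$.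
   Context: Points of $\mathbb{R}^{\mathbb{N}}$ are $x=(x_1,x_2,\ldots)$; $\sigma$ is the left shift; $\mathcal{B}$ is the Borel $\sigma$-algebra of $\mathbb{R}^{\mathbb{N}}$ and $\sigma^n\mathcal{B}=\{(\sigma^n)^{-1}(E):E\in\mathcal{B}\}$ is the $\sigma$-algebra generated by $\sigma^n$. The metric on $\mathbb{R}^{\mathbb{N}}$ is $d(x,y)=\sum_{n\ge 1}\frac{1}{\pi 2^n}|\arctan(x_n)-\arctan(y_n)|$; $\mathcal{H}_\alpha(\mathbb{R}^{\mathbb{N}})$ is the set of real-valued $\alpha$-Hölder functions for $d$ (exponent $\alpha\in(0,1]$ fixed). Fix a strictly positive continuous $f:\mathbb{R}\to\mathbb{R}$ with $\int_{\mathbb{R}} f(a)\,da=1$. Write $S_nA(x)=\sum_{k=0}^{n-1}A(\sigma^k(x))$ and $[x|y]_n=(x_1,\ldots,x_n,y_{n+1},y_{n+2},\ldots)$. For $y\in\mathbb{R}^{\mathbb{N}}$ and $n\in\mathbb{N}$, $\mu_n^y$ is defined on Borel sets $E\subset\mathbb{R}^{\mathbb{N}}$ by $$\mu_n^y(E)=\frac{1}{Z_n^y}\int_{\mathbb{R}^n}e^{S_nA([x|y]_n)}\chi_E([x|y]_n)f(x_1)\cdots f(x_n)\,dx_1\cdots dx_n,$$ with $Z_n^y=\int_{\mathbb{R}^n}e^{S_nA([x|y]_n)}f(x_1)\cdots f(x_n)\,dx_1\cdots dx_n$. *)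

(* Defs.v *)
From HB Require Import structures.
From mathcomp Require Import all_boot all_order all_algebra.
From mathcomp Require Import all_classical all_reals all_analysis.
From mathcomp Require Import measurable_realfun lra.

Set Implicit Arguments.
Unset Strict Implicit.
Unset Printing Implicit Defensive.

Import Order.TTheory GRing.Theory Num.Theory.
Import numFieldNormedType.Exports.

Local Open Scope classical_set_scope.
Local Open Scope ring_scope.

(* Coordinates are numbered from 0: [x k] is the coordinate x_{k+1}. *)
Definition RN (R : realType) : Type := nat -> R.

HB.instance Definition _ (R : realType) := Choice.copy (RN R) (nat -> R).
HB.instance Definition _ (R : realType) := isPointed.Build (RN R) (fun=> 0).

Section distance.
Context {R : realType}.
Implicit Types x y z : RN R.

Definition RN_dist_term x y (n : nat) : R :=
  `|atan (x n) - atan (y n)| / (pi * 2 ^+ n.+1).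

Definition RN_dist x y : R := limn (series (RN_dist_term x y)).

Let den_gt0 n : 0 < pi * 2 ^+ n.+1 :> R.
Proof. by rewrite mulr_gt0// ?pi_gt0// exprn_gt0. Qed.

Let term_ge0 x y n : 0 <= RN_dist_term x y n.
Proof. by rewrite divr_ge0// ltW. Qed.

Let term_le x y n : RN_dist_term x y n <= geometric 1 (2^-1) n.
Proof.
rewrite /RN_dist_term /= mul1r invfM mulrA exprVn.
apply: (@le_trans _ _ (1 * (2 ^+ n.+1)^-1)).
  rewrite ler_wpM2r ?invr_ge0 ?exprn_ge0//.
  rewrite ler_pdivrMr ?pi_gt0// mul1r ler_norml.
  have := atan_gtNpi2 (x n); have := atan_ltpi2 (x n).
  have := atan_gtNpi2 (y n); have := atan_ltpi2 (y n).
  move: (atan (x n)) (atan (y n)) (pi : R) => a b p b1 b2 a1 a2.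
  by apply/andP; split; lra.
rewrite mul1r lef_pV2 ?posrE ?exprn_gt0//.
by rewrite exprS ler_peMl ?exprn_ge0// ler1n.
Qed.

Lemma is_cvg_RN_dist x y : cvgn (series (RN_dist_term x y)).
Proof.
apply: (@series_le_cvg _ _ (geometric 1 (2^-1))).
- exact: term_ge0.
- by move=> n; apply: geometric_ge0; rewrite ?invr_ge0.
- exact: term_le.
- apply: is_cvg_geometric_series.
  by rewrite ger0_norm ?invr_ge0// invf_lt1// ltr1n.
Qed.

Lemma RN_distxx x : RN_dist x x = 0.
Proof.
rewrite /RN_dist (_ : series _ = cst 0) ?lim_cst//.
apply/funext => n; rewrite /series/= big1// => i _.
by rewrite /RN_dist_term subrr normr0 mul0r.
Qed.

Lemma RN_dist_sym x y : RN_dist x y = RN_dist y x.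
Proof.
rewrite /RN_dist (_ : RN_dist_term x y = RN_dist_term y x)//.
by apply/funext => n; rewrite /RN_dist_term distrC.
Qed.

Lemma RN_dist_triangle y x z : RN_dist x z <= RN_dist x y + RN_dist y z.
Proof.
rewrite /RN_dist -lim_seriesD; try exact: is_cvg_RN_dist.
apply: lim_series_le; first exact: is_cvg_RN_dist.
  by apply: is_cvg_seriesD; exact: is_cvg_RN_dist.
move=> n; rewrite /RN_dist_term/= -mulrDl.
by rewrite ler_wpM2r ?ler_distD// invr_ge0 ltW.
Qed.

Lemma RN_dist_positivity x y : RN_dist x y = 0 -> x = y.
Proof.
move=> xy0; apply/funext => n.
have : RN_dist_term x y n <= 0.
  rewrite -xy0; apply: (@le_trans _ _ (series (RN_dist_term x y) n.+1)).
    rewrite /series/= big_nat_recr//= lerDr.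
    by apply: sumr_ge0 => i _; exact: term_ge0.
  apply: nondecreasing_cvgn_le; last exact: is_cvg_RN_dist.
  by apply: nondecreasing_series => i _ _; exact: term_ge0.
rewrite /RN_dist_term pmulr_lle0 ?invr_gt0 ?den_gt0// normr_le0 subr_eq0 => /eqP.
exact: (can_inj (@atanK R)).
Qed.

End distance.

HB.instance Definition _ (R : realType) := @isMetric.Build R (RN R)
  (@RN_dist R) RN_distxx RN_dist_positivity RN_dist_sym RN_dist_triangle.

HB.instance Definition _ (R : realType) :=
  Measurable.copy (RN R) (g_sigma_algebraType (@open (RN R))).

(* Lebesgue measure on R^n: the iterated product [lebesgue_measure \x ...],
   transported from R * R^k to k.+1-tuples; R^0 is a point of mass 1. *)
Fixpoint lebesgue_tuple (R : realType) (n : nat) :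
    set (n.-tuple R) -> \bar R :=
  if n is k.+1 then
    pushforward (@lebesgue_measure R \x @lebesgue_tuple R k)%E
      (fun p : R * k.-tuple R => [tuple of p.1 :: p.2])
  else \d_[tuple].

Section specification.
Context {R : realType}.
Implicit Types (x y z : RN R) (A phi : RN R -> R) (alpha : R) (n r : nat).

Definition is_hoelder alpha phi :=
  exists C : R, forall x y, `|phi x - phi y| <= C * mdist x y `^ alpha.

Definition left_shift x : RN R := fun k => x k.+1.

Definition birkhoff_sum n A x : R := \sum_(k < n) A (iter k left_shift x).

Definition splice n (t : n.-tuple R) y : RN R :=
  fun k => if (k < n)%N then nth 0 t k else y k.

Variables (f : R -> R) (A : RN R -> R).

Definition gibbs_weight n y (t : n.-tuple R) : R :=
  expR (birkhoff_sum n A (splice t y)) * \prod_(i < n) f (tnth t i).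

Local Open Scope ereal_scope.

Definition partition_fun n y : \bar R :=
  \int[@lebesgue_tuple R n]_t (gibbs_weight y t)%:E.

Definition gibbs_mu n y (E : set (RN R)) : \bar R :=
  (partition_fun n y)^-1 *
  \int[@lebesgue_tuple R n]_t (gibbs_weight y t * \1_E (splice t y))%:E.

End specification.

Section gibbsian_specification.
Context {R : realType}.
Local Open Scope ereal_scope.

(* For a family K of set functions, K_n(phi, y) is the integral of phi against
   E |-> K_n(E, y); phi is extended-real valued so that K_n(phi, .) can itself
   be integrated. *)
Definition kernel_int (K : nat -> set (RN R) -> RN R -> \bar R)
    (n : nat) (phi : RN R -> \bar R) (y : RN R) : \bar R :=
  \int[K n ^~ y]_x phi x.

(* The index 0 is excluded, as the family is indexed by n >= 1. *)
Definition gibbsian_specification (alpha : R)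
    (K : nat -> set (RN R) -> RN R -> \bar R) : Prop :=
  [/\ forall (n : nat) (E : set (RN R)), (0 < n)%N -> measurable E ->
        measurable_fun
          [set: g_sigma_algebra_preimageType (iter n (@left_shift R))] (K n E),
      forall (n : nat) (y : RN R), (0 < n)%N ->
        exists P : probability (RN R) R,
          forall E : set (RN R), measurable E -> K n E y = P E
    & forall (n r : nat) (phi : RN R -> R) (z : RN R), (0 < n)%N ->
        is_hoelder alpha phi ->
        kernel_int K (n + r) (EFin \o phi) z =
        kernel_int K (n + r) (kernel_int K n (EFin \o phi)) z].

End gibbsian_specification.

(* Main.v *)
From HB Require Import structures.
Require Import Defs.
From mathcomp Require Import all_boot all_order all_algebra.
From mathcomp Require Import all_classical all_reals all_analysis.
From mathcomp Require Import measurable_realfun lra.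

(* Let [T g y] be the integral over [a] of [e^(A (a y)) f a g (a y)], the Ruelle
   operator for the potential [A] and the a priori density [f].  Integrating out
   the coordinates of [R^n] one at a time (Tonelli), the unnormalized integral
   of [g] against [mu_n^y] is [T^n g] evaluated at the [n]-th shift of [y], so
   [K_n (g, y) = (T^n g / T^n 1) (sigma^n y)].  Measurability with respect to
   [sigma^n B] is then visible.  Compatibility follows from the pull-out rule
   [T^n ((k o sigma^n) * g) = k * T^n g], which gives
   [T^n (K_n (g, .)) = T^n g] and, applying [T^r], the claim. *)

Set Implicit Arguments.
Unset Strict Implicit.
Unset Printing Implicit Defensive.

Import Order.TTheory GRing.Theory Num.Theory.
Import numFieldNormedType.Exports.

Local Open Scope classical_set_scope.
Local Open Scope ring_scope.

(** * Borel structure of the sequence space, and Hölder functions *)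

Lemma metric_continuous {R : realType} {T : metricType R} (phi : T -> R) :
  (forall x (e : R), 0 < e -> exists2 d : R, 0 < d &
    forall y, mdist x y < d -> `|phi x - phi y| < e) -> continuous phi.
Proof.
move=> phiP x; apply/cvgrPdist_lt => e /(phiP x)[d d0 xd].
by apply/nbhs_ballP; exists d => // y; rewrite ballEmdist; exact: xd.
Qed.

Section borel_sequences.
Context {R : realType}.
Implicit Types x y : RN R.

Lemma atan_diff_lt_pi (a b : R) : `|atan a - atan b| < pi.
Proof.
have := atan_gtNpi2 a; have := atan_ltpi2 a.
have := atan_gtNpi2 b; have := atan_ltpi2 b.
rewrite ltr_norml; move: (atan a) (atan b) (pi : R) => u v p b1 b2 a1 a2.
by apply/andP; split; lra.
Qed.

Lemma RN_dist_term_ge0 x y n : 0 <= RN_dist_term x y n.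
Proof. by rewrite divr_ge0// ltW// mulr_gt0// ?pi_gt0// exprn_gt0. Qed.

Lemma RN_dist_term_le x y n : RN_dist_term x y n <= 2^-1 ^+ n.+1.
Proof.
rewrite /RN_dist_term invfM mulrA exprVn ler_piMl ?invr_ge0 ?exprn_ge0//.
by rewrite ler_pdivrMr ?pi_gt0// mul1r ltW// atan_diff_lt_pi.
Qed.

Lemma series_RN_dist_le x y n : series (RN_dist_term x y) n <= RN_dist x y.
Proof.
apply: nondecreasing_cvgn_le; last exact: is_cvg_RN_dist.
by apply: nondecreasing_series => i _ _; exact: RN_dist_term_ge0.
Qed.

(** Term [k] is at most 2^-(k+1), so the tail from [n] on is dominated by a geometric series of sum
    2^-n. *)
Lemma RN_dist_le_head x y n :
  RN_dist x y <= series (RN_dist_term x y) n + 2^-1 ^+ n.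
Proof.
apply: limr_le; first exact: is_cvg_RN_dist.
near=> m.
have nm : (n <= m)%N by near: m; exact: nbhs_infty_ge.
(* The sharper bound, with 2^-m subtracted, is the one that passes through the induction on
   [m - n]. *)
suff : series (RN_dist_term x y) m <=
    series (RN_dist_term x y) n + 2^-1 ^+ n - 2^-1 ^+ m.
  by move/le_trans; apply; rewrite gerBl exprn_ge0// invr_ge0.
rewrite -(subnKC nm); elim: (m - n)%N => [|k ih]; first by rewrite addn0 addrK.
rewrite addnS seriesSr.
apply: (le_trans (lerD ih (RN_dist_term_le x y _))).
rewrite exprS; move: (2^-1 ^+ (n + k)) (2^-1 ^+ n) (series _ n) => e a b.
by lra.
Unshelve. all: by end_near. Qed.

Lemma RN_dist_le1 x y : RN_dist x y <= 1.
Proof.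
by have := RN_dist_le_head x y 0; rewrite /series/= big_geq// add0r expr0.
Qed.

Lemma open_ball_RN (U : set (RN R)) x : open U -> U x ->
  exists2 e : R, 0 < e & forall y, RN_dist x y < e -> U y.
Proof.
move=> oU Ux; have /nbhs_ballP[e /= e0 eU] : nbhs x U by exact: open_nbhs_nbhs.
by exists e => // y xy; apply: eU; rewrite ballEmdist.
Qed.

(** A single term of the series is at most the distance, so this map is Lipschitz with constant pi
    2^(n+1). *)
Lemma continuous_atan_coord n : continuous (fun x : RN R => atan (x n)).
Proof.
apply: metric_continuous => x e e0.
have d0 : 0 < pi * 2 ^+ n.+1 :> R by rewrite mulr_gt0// ?pi_gt0// exprn_gt0.
exists (e / (pi * 2 ^+ n.+1)) => [|y xy]; first exact: divr_gt0.
rewrite -(ltr_pM2r (_ : 0 < (pi * 2 ^+ n.+1)^-1)) ?invr_gt0//.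
apply: le_lt_trans xy; apply: le_trans (series_RN_dist_le x y n.+1).
rewrite /series/= big_nat_recr//= lerDr sumr_ge0// => i _.
exact: RN_dist_term_ge0.
Qed.

Lemma continuous_measurable_RN (phi : RN R -> R) :
  continuous phi -> measurable_fun [set: RN R] phi.
Proof.
move=> /continuousP cphi; apply: (measurability _ (RGenOpens.measurableE R)).
move=> _ [_ [a [b ->] <-]]; rewrite setTI; apply: sub_sigma_algebra.
by apply: cphi; exact: interval_open.
Qed.

Lemma atan_mono : {mono @atan R : a b / a <= b}.
Proof. by apply: le_mono; exact: lt_atan. Qed.

Lemma measurable_coord n : measurable_fun [set: RN R] (fun x => x n).
Proof.
have ma : measurable_fun [set: RN R] (fun x : RN R => atan (x n)).
  by apply: continuous_measurable_RN; exact: continuous_atan_coord.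
move=> mT; apply: (measurability _ (RGenOInfty.measurableE R)) => //.
move=> _ [_ [a ->] <-].
(* Since [atan] is strictly increasing, rays for [x n] are rays for [atan (x n)], whose
   measurability is known. *)
rewrite (_ : _ @^-1` _ = (fun x : RN R => atan (x n)) @^-1` `]atan a, +oo[).
  by apply: ma => //; exact: measurable_itv.
by apply/seteqP; split => x /=; rewrite !in_itv/= !andbT (leW_mono atan_mono).
Qed.

(** Only the first [size s] coordinates are constrained, by rational bounds, so the boxes form a
    countable family. *)
Definition rat_box (s : seq (rat * rat)) : set (RN R) :=
  [set x | forall i, (i < size s)%N ->
    ratr (nth (0, 0) s i).1 < x i < ratr (nth (0, 0) s i).2].

Lemma rat_box_basis (U : set (RN R)) x : open U -> U x ->
  exists2 s, rat_box s x & rat_box s `<=` U.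
Proof.
move=> oU /(open_ball_RN oU)[e e0 eU].
(* Half of [e] covers the tail of the distance; the other half is left for the first [n]
   coordinates. *)
have [n ne] : exists n, 2^-1 ^+ n < e / 2.
  have : (2^-1 : R) ^+ k @[k --> \oo] --> (0 : R).
    by apply: cvg_expr; rewrite ger0_norm ?invr_ge0// invf_lt1// ltr1n.
  move=> /cvgrPdist_lt/(_ _ (divr_gt0 e0 (ltr0Sn _ 1)))[n _ /(_ n (leqnn n))].
  rewrite sub0r normrN ger0_norm ?exprn_ge0// ?invr_ge0// => ne.
  by exists n.
(* The factor [pi] cancels the one in the distance, so term [i] will be at most (e/2) 2^-(i+1). *)
have /choice[q qP] : forall i, exists p : rat * rat,
    ratr p.1 < x i < ratr p.2 /\ forall a : R, ratr p.1 < a < ratr p.2 ->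
      `|atan (x i) - atan a| < e / 2 * pi.
  move=> i; have epi0 : 0 < e / 2 * pi by rewrite mulr_gt0// ?pi_gt0// divr_gt0.
  have /cvgrPdist_lt/(_ _ epi0)[d /= d0 dP] := @continuous_atan R (x i).
  have /rat_in_itvoo[p] : x i - d < x i by rewrite ltrBlDr ltrDl.
  have /rat_in_itvoo[r] : x i < x i + d by rewrite ltrDl.
  rewrite !in_itv/= => /andP[xr rd] /andP[dp px].
  exists (p, r); split => /=; first by rewrite px xr.
  move=> a /andP[pa ar]; apply: dP => /=.
  by rewrite ltr_norml; apply/andP; split; lra.
exists (mkseq q n).
  by move=> i; rewrite size_mkseq => ni; rewrite nth_mkseq//; have [] := qP i.
move=> y yq; apply: eU; apply: le_lt_trans (RN_dist_le_head x y n) _.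
(* The right-hand side is e/2 times the sum of 2^-(i+1) over i < k, in closed form. *)
have : forall k, (k <= n)%N ->
    series (RN_dist_term x y) k <= e / 2 - e / 2 * 2^-1 ^+ k.
  elim=> [|k ih kn]; first by rewrite /series/= big_geq// expr0 mulr1 subrr.
  rewrite seriesSr.
  have : RN_dist_term x y k <= e / 2 * 2^-1 ^+ k.+1.
    have := yq k; rewrite size_mkseq nth_mkseq// => /(_ kn)/(proj2 (qP k))/ltW.
    rewrite -ler_pdivrMr ?pi_gt0// => le.
    by rewrite /RN_dist_term invfM mulrA exprVn ler_wpM2r.
  have := ih (ltnW kn); rewrite exprS.
  by move: (series _ k) (RN_dist_term _ _ _) (2^-1 ^+ k) => a b c; lra.
move=> /(_ n (leqnn n)); have : 0 <= e / 2 * 2^-1 ^+ n.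
  by rewrite mulr_ge0// ?exprn_ge0// ?invr_ge0// divr_ge0// ltW.
by move: ne; move: (series _ _) (2^-1 ^+ n) => a b; lra.
Qed.

(** An open set is the countable union of the rational boxes it contains, and each box is a finite
    intersection of coordinate conditions; hence the coordinates generate the Borel sets. *)
Lemma measurable_fun_RN d (X : measurableType d) (h : X -> RN R) :
  (forall n, measurable_fun [set: X] (fun t => h t n)) ->
  measurable_fun [set: X] h.
Proof.
move=> mh; apply: (measurability (@open (RN R))) => //.
move=> _ [U oU <-]; rewrite setTI.
have -> : h @^-1` U = \bigcup_(s in [set s | rat_box s `<=` U])
    (h @^-1` rat_box s).
  apply/seteqP; split => [t Ut|t [s /= sU /sU//]].
  by have [s st sU] := rat_box_basis oU Ut; exists s.
rewrite bigcup_mkcond; apply: countable_bigcupT_measurable => [|s].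
  exact: countableP.
case: ifPn => // _.
have -> : h @^-1` rat_box s = \bigcap_(i < size s)
    ((fun t => h t i) @^-1`
      `]ratr (nth (0, 0) s i).1, ratr (nth (0, 0) s i).2[).
  apply/seteqP; split => t /= st i; first by move=> /st; rewrite /= in_itv.
  by move=> /st; rewrite /= in_itv.
apply: bigcap_measurableType => i _.
by rewrite -[X in measurable X]setTI; apply: mh => //; exact: measurable_itv.
Qed.

Lemma hoelder_continuous (alpha : R) (phi : RN R -> R) :
  0 < alpha -> is_hoelder alpha phi -> continuous phi.
Proof.
move=> a0 [C phiC]; apply: metric_continuous => x e e0.
(* The Hölder constant may be zero or negative; enlarging it allows division by it. *)
pose C' := Num.max C 1; have C0 : 0 < C' by rewrite lt_max ltr01 orbT.
exists ((e / C') `^ alpha^-1) => [|y xy]; first by rewrite powR_gt0// divr_gt0.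
apply: (@le_lt_trans _ _ (C' * mdist x y `^ alpha)).
  by apply: (le_trans (phiC x y)); rewrite ler_wpM2r ?powR_ge0// le_max lexx.
rewrite mulrC -ltr_pdivlMr//.
have -> : e / C' = (e / C') `^ alpha^-1 `^ alpha.
  by rewrite -powRrM mulVf ?gt_eqF// powRr1// divr_ge0// ltW.
by rewrite gt0_ltr_powR ?nnegrE ?mdist_ge0 ?powR_ge0.
Qed.

(** The space has diameter at most 1, so all values lie within [|C|] of the value at the zero
    sequence. *)
Lemma hoelder_bounded (alpha : R) (phi : RN R -> R) : 0 < alpha ->
  is_hoelder alpha phi -> exists M, forall x, `|phi x| <= M.
Proof.
move=> a0 [C phiC]; exists (`|phi (fun=> 0)| + `|C|) => x.
rewrite -[phi x](subrK (phi (fun=> 0))) addrC.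
apply: (le_trans (ler_normD _ _)); rewrite lerD2l//.
apply: (le_trans (phiC _ _)).
apply: (@le_trans _ _ (`|C| * mdist x (fun=> 0) `^ alpha)).
  by rewrite ler_wpM2r ?powR_ge0// ler_norm.
rewrite ler_piMr//; apply: (@le_trans _ _ (1 `^ alpha)); last by rewrite powR1.
by rewrite ge0_ler_powR ?nnegrE ?mdist_ge0// ?(ltW a0)//; exact: RN_dist_le1.
Qed.

End borel_sequences.

(** * Lebesgue measure on tuples, and image measures with a density *)

(** [lebesgue_tuple] is a bare set function, while Tonelli needs a sigma-finite measure. By
    induction, a product of two such measures is transported along a bijection with measurable
    inverse. *)
Lemma lebesgue_tuple_sigma_finite (R : realType) n :
  exists mu : {sigma_finite_measure set (n.-tuple R) -> \bar R},
    (mu : set _ -> \bar R) = @lebesgue_tuple R n.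
Proof.
elim: n => [|n [mu muE]]; first by exists (\d_[tuple]).
pose c (p : R * n.-tuple R) : n.+1.-tuple R := [tuple of p.1 :: p.2].
have mc : measurable_fun [set: R * n.-tuple R] c by exact: measurable_cons.
pose m := measure_function_pushforward__canonical__measure_function_Measure
  (@lebesgue_measure R \x mu)%E mc.
have sf : sigma_finite setT m.
  have /sigma_finiteP[F [TF ndF Foo]] := sigma_finiteT (@lebesgue_measure R).
  have /sigma_finiteP[G [TG ndG Goo]] := sigma_finiteT mu.
  (* The inverse of [c]; pulling the rectangles F_i x G_i back along it gives an exhaustion of the
     tuples by sets of finite measure. *)
  pose u (t : n.+1.-tuple R) := (thead t, [tuple of behead t]).
  have uc p : u (c p) = p.
    by case: p => a t; rewrite /u /c theadE; congr pair; apply/val_inj.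
  have mu_ : measurable_fun setT u.
    apply: measurable_fun_pair; first exact: measurable_tnth.
    exact: measurable_behead.
  exists (fun i => u @^-1` (F i `*` G i)).
    apply/esym/seteqP; split => // t _.
    have [i _ Fi] : (\bigcup_i F i) (u t).1 by rewrite -TF.
    have [j _ Gj] : (\bigcup_i G i) (u t).2 by rewrite -TG.
    (* Both exhaustions are nondecreasing, so a common index exists. *)
    exists (maxn i j) => //; split => /=.
      by apply: (subsetPset _ _ (ndF _ _ (leq_maxl i j))).
    by apply: (subsetPset _ _ (ndG _ _ (leq_maxr i j))).
  move=> i; have [mF Fi] := Foo i; have [mG Gi] := Goo i; split.
    by rewrite -[X in measurable X]setTI; apply: mu_ => //; exact: measurableX.
  rewrite /m/= /pushforward (_ : _ @^-1` _ = F i `*` G i); last first.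
    by apply/seteqP; split => p; rewrite /preimage /mkset uc.
  by rewrite product_measure1E// lte_mul_pinfty// ge0_fin_numE.
pose H := isSigmaFinite.Build _ _ _ m sf.
pose H' := isSFinite.Build _ _ _ m (sfinite_measure_sigma_finite sf).
exists (HB.pack_for {sigma_finite_measure set (n.+1.-tuple R) -> \bar R}
  (Measure.sort m) H H').
by rewrite /= -muE.
Qed.

Section weighted_pushforward.
Context d1 d2 (X : measurableType d1) (Y : measurableType d2) (R : realType).
Variables (mu : {measure set X -> \bar R}) (W : X -> R) (h : X -> Y).
Hypotheses (mW : measurable_fun setT W) (W0 : forall x, 0 <= W x).
Hypothesis mh : measurable_fun setT h.
Local Open Scope ereal_scope.

Import HBNNSimple.

(** The image under [h] of the measure with density [W]. The integral formula holds for indicators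
    by construction, then for simple functions by linearity, and in general by monotone
    convergence. *)
Lemma weighted_pushforward_measure :
  exists nu : {measure set Y -> \bar R},
    forall g : Y -> \bar R, measurable_fun setT g -> (forall y, 0 <= g y) ->
      \int[nu]_y g y = \int[mu]_x ((W x)%:E * g (h x)).
Proof.
have mWE : measurable_fun setT (EFin \o W) by exact/measurable_EFinP.
pose n E := \int[mu]_x ((W x)%:E * (\1_E (h x))%:E).
have nE E : n E = \int[mu]_(x in h @^-1` E) (W x)%:E.
  rewrite [RHS]integral_mkcond; apply: eq_integral => x _.
  rewrite patchE indicE; have -> : (x \in h @^-1` E) = (h x \in E).
    by apply/idP/idP; rewrite !inE.
  by case: ifPn; rewrite ?mule1 ?mule0.
have n0 : n set0 = 0 by rewrite nE preimage_set0 integral_set0.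
have n_ge0 E : 0 <= n E by rewrite nE integral_ge0// => x _; rewrite lee_fin.
have mhI E : measurable E -> measurable (h @^-1` E).
  by move=> mE; rewrite -[X in measurable X]setTI; exact: mh.
have nsa : semi_sigma_additive n.
  move=> F mF tF mUF; rewrite nE preimage_bigcup.
  rewrite (_ : (fun k => _) = (fun k => \sum_(0 <= i < k)
    \int[mu]_(x in h @^-1` F i) (W x)%:E)); last first.
    by apply/funext => k; apply: eq_bigr => i _; rewrite nE.
  (* Preimages under [h] preserve disjoint unions, so additivity reduces to that of the measure with
     density [W]. *)
  apply: (@semi_sigma_additive_nng_induced _ _ _ mu (EFin \o W) _ _
    (fun i => h @^-1` F i)) => //.
  - by move=> i; exact: mhI.
  - apply/trivIsetP => /= i j _ _ ij; rewrite -preimage_setI.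
    by move/trivIsetP : tF => /(_ _ _ _ _ ij) ->//; rewrite preimage_set0.
  - by rewrite -preimage_bigcup; exact: mhI.
pose nu : {measure set Y -> \bar R} :=
  HB.pack n (isMeasure.Build _ _ _ n n0 n_ge0 nsa).
have mhC (g : Y -> \bar R) : measurable_fun setT g ->
    measurable_fun setT (fun x => g (h x)).
  by move=> mg; exact: measurableT_comp.
exists nu => g mg g0.
pose g_ := nnsfun_approx measurableT mg.
have g_cvg y : (g_ k y)%:E @[k --> \oo] --> g y by exact: cvg_nnsfun_approx.
have mg_ k : measurable_fun setT (fun y => (g_ k y)%:E).
  by apply/measurable_EFinP; exact: measurable_funP.
transitivity (limn (fun k => \int[nu]_y (g_ k y)%:E)).
  rewrite -monotone_convergence//.
  - by apply: eq_integral => y _; exact/esym/cvg_lim.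
  - by move=> k y _; rewrite lee_fin.
  - by move=> y _ a b ab; rewrite lee_fin; exact/lefP/nd_nnsfun_approx.
transitivity (limn (fun k =>
    \int[mu]_x ((W x)%:E * (g_ k (h x))%:E))); last first.
  rewrite -monotone_convergence//.
  - apply: eq_integral => x _; apply/cvg_lim => //.
    by apply: cvgeZl => //; exact: g_cvg.
  - by move=> k; apply: emeasurable_funM => //; exact: mhC (mg_ k).
  - by move=> k x _; rewrite mule_ge0// lee_fin.
  - move=> x _ a b ab; apply: lee_wpmul2l; rewrite lee_fin//.
    exact/lefP/nd_nnsfun_approx.
congr (limn _); apply/funext => k.
rewrite integralT_nnsfun sintegralE.
transitivity (\int[mu]_x (\sum_(r \in range (g_ k))
   (r%:E * ((W x)%:E * (\1_(g_ k @^-1` [set r]) (h x))%:E)))); last first.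
  apply: eq_integral => x _; rewrite fimfunE -fsumEFin//.
  rewrite ge0_mule_fsumr; last first.
    by move=> r; rewrite nnfun_muleindic_ge0.
  by apply: eq_fsbigr => r _; rewrite EFinM muleCA.
rewrite ge0_integral_fsum//; last 2 first.
- move=> r; apply: emeasurable_funM => //; apply: emeasurable_funM => //.
  apply: (mhC (fun y => (\1_(g_ k @^-1` [set r]) y)%:E)).
  by apply/measurable_EFinP; exact: measurable_indic.
- move=> r x _; rewrite muleCA; apply: mule_ge0; first by rewrite lee_fin.
  exact: nnfun_muleindic_ge0.
apply: eq_fsbigr => r _.
(* A nonnegative simple function has empty fibres over negative values, so both sides vanish
   there. *)
have [r0|r0] := leP 0%R r; last first.
  rewrite preimage_nnfun0// measure0 mule0 integral0_eq// => x _.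
  by rewrite indic0 !mule0.
rewrite -ge0_integralZl//.
  apply: emeasurable_funM => //.
  apply: (mhC (fun y => (\1_(g_ k @^-1` [set r]) y)%:E)).
  by apply/measurable_EFinP; exact: measurable_indic.
by move=> x _; rewrite mule_ge0// lee_fin.
Qed.

End weighted_pushforward.

(** * Concatenating a finite word with a sequence *)

Section prepending.
Context {R : realType}.
Implicit Types (x y : RN R) (n : nat).

Definition consRN (a : R) y : RN R := fun k => if k is k'.+1 then y k' else a.

Definition prepend n (t : n.-tuple R) y : RN R :=
  fun k => if (k < n)%N then nth 0 t k else y (k - n)%N.

Lemma iter_left_shift n y k : iter n left_shift y k = y (n + k)%N.
Proof.
by elim: n y k => [//|n ih] y k; rewrite iterS /left_shift ih addnS.
Qed.

Lemma left_shift_consRN a y : left_shift (consRN a y) = y.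
Proof. by []. Qed.

(** Splicing overwrites the first [n] coordinates of [y], so it depends on [y] only through sigma^n
    y. This is the source of the measurability with respect to sigma^n B. *)
Lemma splice_prepend n (t : n.-tuple R) y :
  splice t y = prepend t (iter n left_shift y).
Proof.
apply/funext => k; rewrite /splice /prepend; case: ltnP => // nk.
by rewrite iter_left_shift subnKC.
Qed.

Lemma prepend_cons n a (t : n.-tuple R) y :
  prepend [tuple of a :: t] y = consRN a (prepend t y).
Proof. by apply/funext => -[|k]. Qed.

Lemma prepend_nil (t : 0.-tuple R) y : prepend t y = y.
Proof. by apply/funext => k; rewrite /prepend subn0. Qed.

Lemma measurable_iter_left_shift n :
  measurable_fun [set: RN R] (iter n left_shift).
Proof.
apply: measurable_fun_RN => k.
rewrite (_ : (fun t => _) = (fun y : RN R => y (n + k)%N)).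
  exact: measurable_coord.
by apply/funext => y; rewrite iter_left_shift.
Qed.

Lemma measurable_consRN :
  measurable_fun [set: R * RN R] (fun p => consRN p.1 p.2).
Proof.
apply: measurable_fun_RN => -[|k] /=; first exact: measurable_fst.
by apply: (measurableT_comp (measurable_coord k)); exact: measurable_snd.
Qed.

Lemma measurable_prepend n y :
  measurable_fun [set: n.-tuple R] (fun t => prepend t y).
Proof.
apply: measurable_fun_RN => k; rewrite /prepend; case: ltnP => nk.
  rewrite (_ : (fun t : n.-tuple R => _) = (@tnth _ R)^~ (Ordinal nk)).
    exact: measurable_tnth.
  by apply/funext => t; rewrite (tnth_nth 0).
exact: measurable_cst.
Qed.

End prepending.

(** * The Ruelle operator and iterated integration *)

Section ruelle.
Context {R : realType}.
Variables (f : R -> R) (A : RN R -> R).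
Hypotheses (mf : measurable_fun setT f) (f_ge0 : forall a, 0 <= f a).
Hypothesis mA : measurable_fun setT A.

(** The Gibbs weight as a function of the tail that follows the word, that is, of the already
    shifted sequence. *)
Definition word_weight n (t : n.-tuple R) (y : RN R) : R :=
  expR (birkhoff_sum n A (prepend t y)) * \prod_(i < n) f (tnth t i).

Lemma gibbs_weight_word n y (t : n.-tuple R) :
  gibbs_weight f A y t = word_weight t (iter n left_shift y).
Proof. by rewrite /gibbs_weight splice_prepend. Qed.

Lemma word_weight_nil (t : 0.-tuple R) y : word_weight t y = 1.
Proof. by rewrite /word_weight /birkhoff_sum !big_ord0 expR0 mulr1. Qed.

Lemma word_weight_ge0 n (t : n.-tuple R) y : 0 <= word_weight t y.
Proof. by rewrite mulr_ge0 ?expR_ge0// prodr_ge0. Qed.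

(** The first term of the Birkhoff sum is [A] at the whole sequence; one shift drops [a], and the
    other terms form the Birkhoff sum for [t]. *)
Lemma word_weight_cons n a (t : n.-tuple R) y :
  word_weight [tuple of a :: t] y =
  word_weight t y * (expR (A (consRN a (prepend t y))) * f a).
Proof.
rewrite /word_weight /birkhoff_sum prepend_cons !big_ord_recl /= tnth0 expRD.
rewrite (eq_bigr (fun k : 'I_n => A (iter k left_shift (prepend t y)))).
  rewrite [X in X * _]mulrC [f a * _]mulrC mulrACA; congr (_ * _ * _).
  by apply: eq_bigr => i _; rewrite !(tnth_nth 0).
by move=> k _; rewrite -iterS iterSr left_shift_consRN.
Qed.

Lemma measurable_word_weight n y :
  measurable_fun [set: n.-tuple R] (fun t => word_weight t y).
Proof.
apply: measurable_funM.
  apply: measurableT_comp; first exact: measurable_expR.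
  apply: measurable_sum => i; apply: (measurableT_comp mA).
  apply: (measurableT_comp (measurable_iter_left_shift _)).
  exact: measurable_prepend.
apply: measurable_prod => i _; apply: (measurableT_comp mf).
exact: measurable_tnth.
Qed.

Local Open Scope ereal_scope.

Definition ruelle (g : RN R -> \bar R) (y : RN R) : \bar R :=
  \int[lebesgue_measure]_a
    ((expR (A (consRN a y)) * f a)%:E * g (consRN a y)).

Definition word_int n (g : RN R -> \bar R) (y : RN R) : \bar R :=
  \int[@lebesgue_tuple R n]_t ((word_weight t y)%:E * g (prepend t y)).

Lemma ruelle_weight_ge0 a y : 0 <= (expR (A (consRN a y)) * f a)%:E.
Proof. by rewrite lee_fin mulr_ge0// expR_ge0. Qed.

Lemma measurable_ruelle_integrand g : measurable_fun setT g ->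
  measurable_fun [set: R * RN R]
   (fun p => (expR (A (consRN p.1 p.2)) * f p.1)%:E * g (consRN p.1 p.2)).
Proof.
move=> mg; apply: emeasurable_funM; last first.
  by apply: (measurableT_comp mg); exact: measurable_consRN.
apply/measurable_EFinP; apply: measurable_funM; last first.
  exact: (measurableT_comp mf).
apply: measurableT_comp; first exact: measurable_expR.
by apply: (measurableT_comp mA); exact: measurable_consRN.
Qed.

Lemma ruelle_ge0 g : (forall y, 0 <= g y) -> forall y, 0 <= ruelle g y.
Proof.
move=> g0 y; apply: integral_ge0 => a _.
by rewrite mule_ge0// ruelle_weight_ge0.
Qed.

Lemma measurable_ruelle g : measurable_fun setT g -> (forall y, 0 <= g y) ->
  measurable_fun setT (ruelle g).
Proof.
move=> mg g0; apply: (measurable_fun_fubini_tonelli_G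
  (m1 := @lebesgue_measure R) _ (measurable_ruelle_integrand mg)).
by move=> [a y]; rewrite mule_ge0// ruelle_weight_ge0.
Qed.

Lemma word_int_nil g y : measurable_fun setT g -> (forall y, 0 <= g y) ->
  word_int 0 g y = g y.
Proof.
move=> mg g0; rewrite /word_int /=.
rewrite integral_dirac//= ?diracT ?mul1e ?word_weight_nil ?mul1e ?prepend_nil//.
under eq_fun do rewrite word_weight_nil prepend_nil.
exact: measurable_cst.
Qed.

(** By Tonelli the head letter [a] is integrated first. The weight of [t] does not involve [a] and
    factors out, and what remains inside is [ruelle g] at [prepend t y]. *)
Lemma word_intS n g y : measurable_fun setT g -> (forall y, 0 <= g y) ->
  word_int n.+1 g y = word_int n (ruelle g) y.
Proof.
move=> mg g0; have [mu muE] := lebesgue_tuple_sigma_finite R n.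
pose G (s : n.+1.-tuple R) := (word_weight s y)%:E * g (prepend s y).
have mG : measurable_fun setT G.
  apply: emeasurable_funM.
    by apply/measurable_EFinP; exact: measurable_word_weight.
  by apply: (measurableT_comp mg); exact: measurable_prepend.
have G0 s : 0 <= G s by rewrite mule_ge0// lee_fin word_weight_ge0.
rewrite /word_int/= -muE ge0_integral_pushforward//; last 2 first.
- exact: measurable_cons.
- by move=> s _; exact: G0.
rewrite preimage_setT (fubini_tonelli2 (m2 := mu)); last 2 first.
- by apply: (measurableT_comp mG); exact: measurable_cons.
- by move=> p; exact: G0.
apply: eq_integral => t _; rewrite /fubini_G/=.
under eq_integral do rewrite word_weight_cons prepend_cons EFinM -muleA.
rewrite ge0_integralZl//.
- by apply: (measurable_fun_pair1 _ (measurable_ruelle_integrand mg)).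
- by move=> a _; rewrite mule_ge0// ruelle_weight_ge0.
- by rewrite lee_fin word_weight_ge0.
Qed.

Lemma word_int_ruelle n g y : measurable_fun setT g -> (forall y, 0 <= g y) ->
  word_int n g y = iter n ruelle g y.
Proof.
elim: n g => [|n ih] g mg g0; first exact: word_int_nil.
rewrite word_intS// ih ?iterSr//; first exact: measurable_ruelle.
exact: ruelle_ge0.
Qed.

End ruelle.

(** * Normalized Ruelle iterates and the Gibbs kernel as a probability *)

Section unit_mass.
Context d (Y : measurableType d) (R : realType).
Variables (nu : {measure set Y -> \bar R}) (nuT : nu setT = 1%E).

(* The proof argument makes the instance of probability inferable. *)
Definition unit_mass (_ : nu setT = 1%E) : set Y -> \bar R := nu.

HB.instance Definition _ := Measure.on (unit_mass nuT).
HB.instance Definition _ :=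
  @Measure_isProbability.Build _ _ _ (unit_mass nuT) nuT.

Lemma probability_of_unit_mass :
  exists P : probability Y R, (P : set Y -> \bar R) = nu.
Proof. by exists (unit_mass nuT). Qed.

End unit_mass.

Section gibbs_kernel.
Context {R : realType}.
Variables (f : R -> R) (A : RN R -> R) (M : R).
Hypotheses (mf : measurable_fun setT f) (f_ge0 : forall a, 0 <= f a).
Hypothesis f_int : (\int[lebesgue_measure]_a (f a)%:E = 1)%E.
Hypotheses (mA : measurable_fun setT A) (AM : forall x, `|A x| <= M).
Local Open Scope ereal_scope.
Local Notation T := (ruelle f A).
Local Notation Z n := (iter n T (cst (1 : \bar R))).

Lemma iter_ruelle_ge0 n (g : RN R -> \bar R) :
  (forall y, 0 <= g y) -> forall y, 0 <= iter n T g y.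
Proof. by move=> g0; elim: n => [//|n ih] y; exact: ruelle_ge0. Qed.

Lemma measurable_iter_ruelle n (g : RN R -> \bar R) :
  measurable_fun setT g -> (forall y, 0 <= g y) ->
  measurable_fun setT (iter n T g).
Proof.
move=> mg g0; elim: n => [//|n ih]; apply: measurable_ruelle => //.
exact: iter_ruelle_ge0.
Qed.

Lemma measurable_ruelle_section (g : RN R -> \bar R) y :
  measurable_fun setT g ->
  measurable_fun [set: R]
   (fun a => (expR (A (consRN a y)) * f a)%:E * g (consRN a y)).
Proof.
move=> mg.
exact: (measurable_fun_pair1 _ (measurable_ruelle_integrand mf mA mg)).
Qed.

(** Shifting undoes the prepending of [a], so the factor [k] is constant in the integration
    variable. *)
Lemma ruelle_shift (k g : RN R -> \bar R) y :
  measurable_fun setT g -> (forall y, 0 <= g y) -> (forall y, 0 <= k y) ->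
  T (fun x => k (left_shift x) * g x) y = k y * T g y.
Proof.
move=> mg g0 k0; rewrite /ruelle -ge0_integralZl//; last 2 first.
- exact: measurable_ruelle_section.
- by move=> a _; rewrite mule_ge0// ruelle_weight_ge0.
by apply: eq_integral => a _; rewrite left_shift_consRN muleCA.
Qed.

Lemma iter_ruelle_shift n (k g : RN R -> \bar R) y :
  measurable_fun setT g -> (forall y, 0 <= g y) -> (forall y, 0 <= k y) ->
  iter n T (fun x => k (iter n left_shift x) * g x) y = k y * iter n T g y.
Proof.
move=> mg g0 k0; elim: n g mg g0 => [//|n ih] g mg g0.
rewrite iterSr [in RHS]iterSr -ih//; last 2 first.
- exact: measurable_ruelle.
- exact: ruelle_ge0.
congr (iter n T _ y); apply/funext => x.
(* The innermost [T] absorbs one of the n+1 shifts; the induction hypothesis, applied to [T g],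
   handles the other n. *)
rewrite -(ruelle_shift (k := fun x => k (iter n left_shift x)))//.
by congr (T _ x); apply/funext => z; rewrite iterSr.
Qed.

Lemma integral_cst_density (c : R) : (0 <= c)%R ->
  \int[lebesgue_measure]_a (c%:E * (f a)%:E) = c%:E.
Proof.
move=> c0; rewrite ge0_integralZl//; last 2 first.
- exact/measurable_EFinP.
- by move=> a _; rewrite lee_fin.
by rewrite f_int mule1.
Qed.

(** As [A] is at least [- M] and [f] has mass 1, each application of [T] costs at most a factor
    [expR (- M)]. With the matching upper bound, [Z n y] is positive and finite, hence
    invertible. *)
Lemma iter_ruelle1_ge n y : (expR (- M) ^+ n)%:E <= Z n y.
Proof.
elim: n y => [|n ih] y; first by rewrite expr0.
rewrite iterS /ruelle -[leLHS]integral_cst_density ?exprn_ge0 ?expR_ge0//.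
apply: ge0_le_integral => //.
- by move=> a _; rewrite mule_ge0// lee_fin// exprn_ge0// expR_ge0.
- by apply/measurable_EFinP/measurable_funM => //; exact: measurable_cst.
- by apply: measurable_ruelle_section; exact: measurable_iter_ruelle.
move=> a _; rewrite exprS -EFinM mulrAC EFinM lee_pmul//.
- by rewrite lee_fin mulr_ge0// expR_ge0.
- rewrite lee_fin ler_wpM2r// ler_expR lerNl; apply: le_trans (AM (consRN a y)).
  by rewrite -normrN ler_norm.
Qed.

Lemma iter_ruelle1_le n y : Z n y <= (expR M ^+ n)%:E.
Proof.
elim: n y => [|n ih] y; first by rewrite expr0.
rewrite iterS /ruelle -[leRHS]integral_cst_density ?exprn_ge0 ?expR_ge0//.
apply: ge0_le_integral => //.
- by move=> a _; rewrite mule_ge0 ?ruelle_weight_ge0//; exact: iter_ruelle_ge0.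
- by apply: measurable_ruelle_section; exact: measurable_iter_ruelle.
- by apply/measurable_EFinP/measurable_funM => //; exact: measurable_cst.
move=> a _; rewrite exprS -[leRHS]EFinM mulrAC [leRHS]EFinM lee_pmul//.
- by rewrite ruelle_weight_ge0.
- exact: iter_ruelle_ge0.
- rewrite lee_fin ler_wpM2r// ler_expR; apply: le_trans (AM (consRN a y)).
  by rewrite ler_norm.
Qed.

Lemma iter_ruelle1_gt0 n y : 0 < Z n y.
Proof.
apply: lt_le_trans (iter_ruelle1_ge n y).
by rewrite lte_fin exprn_gt0// expR_gt0.
Qed.

Lemma iter_ruelle1_fin_num n y : Z n y \is a fin_num.
Proof.
rewrite ge0_fin_numE ?ltW ?iter_ruelle1_gt0//.
by apply: le_lt_trans (iter_ruelle1_le n y) _; rewrite ltry.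
Qed.

Definition normalized_ruelle n (g : RN R -> \bar R) y :=
  (Z n y)^-1 * iter n T g y.

Lemma normalized_ruelle_ge0 n g : (forall y, 0 <= g y) ->
  forall y, 0 <= normalized_ruelle n g y.
Proof.
move=> g0 y; rewrite mule_ge0 ?iter_ruelle_ge0// inve_ge0.
by rewrite ltW// iter_ruelle1_gt0.
Qed.

Lemma measurable_normalized_ruelle n g :
  measurable_fun setT g -> (forall y, 0 <= g y) ->
  measurable_fun setT (normalized_ruelle n g).
Proof.
move=> mg g0; apply: emeasurable_funM; last exact: measurable_iter_ruelle.
(* For a positive finite value the inverse equals exp(-ln), a composition of measurable
   functions. *)
rewrite (_ : (fun y => _) =
    (fun y : RN R => (expR (- ln (fine (Z n y))))%:E)); last first.
  apply/funext => y; have Z0 := iter_ruelle1_gt0 n y.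
  have Zf := iter_ruelle1_fin_num n y.
  move: Z0 Zf; case: (Z n y) => [z| |]//; rewrite lte_fin => z0 _.
  by rewrite inver gt_eqF//= expRN lnK.
apply/measurable_EFinP; apply: measurableT_comp; first exact: measurable_expR.
apply: measurableT_comp => //.
apply: measurableT_comp; first exact: measurable_ln.
apply: measurableT_comp; first exact: fine_measurable.
exact: measurable_iter_ruelle.
Qed.

(** The function under T^n depends on sigma^n x alone, so it is pulled out; the remaining factor T^n
    1 cancels the normalization. *)
Lemma iter_normalized_ruelle n g y :
  measurable_fun setT g -> (forall y, 0 <= g y) ->
  iter n T (fun x => normalized_ruelle n g (iter n left_shift x)) y =
  iter n T g y.
Proof.
move=> mg g0.
rewrite (_ : (fun x => _) = fun x =>
    normalized_ruelle n g (iter n left_shift x) * cst 1 x); last first.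
  by apply/funext => x; rewrite mule1.
rewrite iter_ruelle_shift//; last exact: normalized_ruelle_ge0.
rewrite muleAC mulVe ?mul1e ?iter_ruelle1_fin_num// gt_eqF//.
exact: iter_ruelle1_gt0.
Qed.

Lemma normalized_ruelle_compat n r g y :
  measurable_fun setT g -> (forall y, 0 <= g y) ->
  normalized_ruelle (n + r)
    (fun x => normalized_ruelle n g (iter n left_shift x)) y =
  normalized_ruelle (n + r) g y.
Proof.
move=> mg g0; rewrite /normalized_ruelle; congr (_ * _).
(* The sum is reordered so that T^n acts first and T^r afterwards. *)
rewrite addnC !iterD; congr (iter r T _ y); apply/funext => x.
exact: iter_normalized_ruelle.
Qed.

Lemma gibbs_muE n y E : measurable E ->
  gibbs_mu f A n y E =
  normalized_ruelle n (fun x => (\1_E x)%:E) (iter n left_shift y).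
Proof.
move=> mE; rewrite /gibbs_mu /partition_fun /normalized_ruelle.
rewrite -!word_int_ruelle//; last first.
  by apply/measurable_EFinP; exact: measurable_indic.
congr (inve _ * _); congr (integral _ _ _); apply/funext => t.
  by rewrite gibbs_weight_word mule1.
by rewrite gibbs_weight_word splice_prepend EFinM.
Qed.

(** The probability is the image under [prepend] of the normalized word weight. Its integral formula
    covers all nonnegative measurable functions, as compatibility requires, and the constant 1 gives
    total mass 1. *)
Lemma gibbs_probability n y :
  exists P : probability (RN R) R,
    (forall E, measurable E -> gibbs_mu f A n y E = P E) /\
    (forall g, measurable_fun setT g -> (forall x, 0 <= g x) ->
      \int[P]_x g x = normalized_ruelle n g (iter n left_shift y)).
Proof.
have [mu muE] := lebesgue_tuple_sigma_finite R n.
set y' := iter n left_shift y.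
pose z := fine (Z n y').
have Zf := iter_ruelle1_fin_num n y'.
have zE : (Z n y')^-1 = (z^-1)%:E.
  rewrite -[in LHS](fineK Zf) inver gt_eqF// fine_gt0// iter_ruelle1_gt0/=.
  by rewrite ltey_eq Zf.
have z0 : (0 <= z^-1)%R.
  by rewrite invr_ge0 fine_ge0// ltW// iter_ruelle1_gt0.
have [|||nu nu_int] := @weighted_pushforward_measure _ _ _ _ R mu
  (fun t : n.-tuple R => z^-1 * word_weight f A t y')%R (fun t => prepend t y').
- by apply: measurable_funM => //; exact: measurable_word_weight.
- by move=> t; rewrite mulr_ge0// word_weight_ge0.
- exact: measurable_prepend.
have nu_int' g : measurable_fun setT g -> (forall x, 0 <= g x) ->
    \int[nu]_x g x = normalized_ruelle n g y'.
  move=> mg g0; rewrite nu_int// /normalized_ruelle zE -word_int_ruelle//.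
  under eq_integral do rewrite EFinM -muleA.
  rewrite ge0_integralZl//; last 2 first.
  - apply: emeasurable_funM.
      by apply/measurable_EFinP; exact: measurable_word_weight.
    by apply: (measurableT_comp mg); exact: measurable_prepend.
  - by move=> t _; rewrite mule_ge0// lee_fin word_weight_ge0.
  by rewrite /word_int -muE.
have nu1 E : measurable E ->
    nu E = normalized_ruelle n (fun x => (\1_E x)%:E) y'.
  move=> mE; rewrite -nu_int'//; last first.
    by apply/measurable_EFinP; exact: measurable_indic.
  by rewrite integral_indic// setIT.
have nuT : nu setT = 1.
  rewrite nu1//; under eq_fun do rewrite indicT.
  rewrite /normalized_ruelle mulVe ?iter_ruelle1_fin_num// gt_eqF//.
  by rewrite iter_ruelle1_gt0.
have [P PE] := probability_of_unit_mass nuT.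
exists P; split => [E mE|g mg g0]; first by rewrite gibbs_muE// -nu1// -PE.
by rewrite -nu_int'// -PE.
Qed.

End gibbs_kernel.

(** * Verification of the three conditions *)

Section eq_integral_set_function.
Import HBNNSimple.

(* [eq_measure_integral] requires set functions that are packaged as measures,
   which [gibbs_mu] is not. *)
Lemma eq_integral_set_function d (X : measurableType d) (R : realType)
    (m1 m2 : set X -> \bar R) (g : X -> \bar R) :
  (forall E, measurable E -> m1 E = m2 E) ->
  (\int[m1]_x g x = \int[m2]_x g x)%E.
Proof.
move=> m12; rewrite /integral.
have sE (h : {nnsfun X >-> R}) : sintegral m1 h = sintegral m2 h.
  by apply: eq_fsbigr => r _; rewrite m12.
by congr (ereal_sup _ - ereal_sup _)%E; apply: eq_imagel => h _; exact: sE.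
Qed.

End eq_integral_set_function.

Theorem lemma4p1 (R : realType) (alpha : R) (halpha : 0 < alpha <= 1)
    (f : R -> R) (f_cont : continuous f) (f_gt0 : forall a : R, 0 < f a)
    (f_int : (\int[lebesgue_measure]_a (f a)%:E = 1)%E)
    (A : RN R -> R) (hA : is_hoelder alpha A) :
  gibbsian_specification alpha (fun n E y => gibbs_mu f A n y E).
Proof.
have /andP[alpha0 _] := halpha.
have mf : measurable_fun setT f by exact: continuous_measurable_fun.
have f0 a : 0 <= f a by exact: ltW.
have mhoelder phi : is_hoelder alpha phi -> measurable_fun setT phi.
  move=> hphi; apply: continuous_measurable_RN.
  exact: hoelder_continuous hphi.
have mA := mhoelder _ hA.
have [M AM] := hoelder_bounded alpha0 hA.
pose N := normalized_ruelle f A.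
have mN n g : measurable_fun setT g -> (forall y, 0 <= g y)%E ->
    measurable_fun setT (N n g).
  exact: (measurable_normalized_ruelle mf f0 f_int mA AM).
have N0 n g : (forall y, 0 <= g y)%E -> forall y, (0 <= N n g y)%E.
  exact: (normalized_ruelle_ge0 mf f0 f_int mA AM).
split.
- move=> n E _ mE _ B mB; rewrite setTI.
  (* The kernel is [N n] of the indicator composed with the n-th shift, so this Borel set is the one
     whose preimage under the shift is sought. *)
  exists (N n (fun x => (\1_E x)%:E) @^-1` B).
    rewrite -[X in measurable X]setTI; apply: mN => //.
    by apply/measurable_EFinP; exact: measurable_indic.
  rewrite setTI; apply/seteqP.
  by split => y /=; rewrite (gibbs_muE mf f0 mA).
- move=> n y _; have [P [PE _]] := gibbs_probability mf f0 f_int mA AM n y.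
  by exists P.
- move=> n r phi z _ hphi.
  have mphi : measurable_fun setT (EFin \o phi).
    by apply/measurable_EFinP; exact: mhoelder.
  have [C phiC] := hoelder_bounded alpha0 hphi.
  (* The operator identities hold for nonnegative functions, so the positive and negative parts are
     treated separately. *)
  pose u := (EFin \o phi)^\+%E; pose v := (EFin \o phi)^\-%E.
  have mu : measurable_fun setT u by exact: measurable_funepos.
  have mv : measurable_fun setT v by exact: measurable_funeneg.
  have u0 x : (0 <= u x)%E by exact: funepos_ge0.
  have v0 x : (0 <= v x)%E by exact: funeneg_ge0.
  (* Integrals against the bare set function become integrals against a chosen probability agreeing
     with it on Borel sets. *)
  have KE m y g : kernel_int (fun n E y => gibbs_mu f A n y E) m g y =
      (\int[sval (cid (gibbs_probability mf f0 f_int mA AM m y))]_x g x)%E.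
    by case: cid => P [PE _] /=; apply: eq_integral_set_function.
  have Kn y : kernel_int (fun n E y => gibbs_mu f A n y E) n (EFin \o phi) y =
      (N n u (iter n left_shift y) - N n v (iter n left_shift y))%E.
    rewrite KE; case: cid => P [_ PN] /=.
    by rewrite integralE !PN.
  rewrite !KE; case: cid => P [_ PN] /=.
  rewrite [RHS](eq_integral (fun y =>
    (N n u (iter n left_shift y) - N n v (iter n left_shift y))%E)); last first.
    by move=> y _; exact: Kn.
  (* Boundedness of [phi] makes both parts integrable, so that the integral of their difference can
     be split. *)
  have iphi : P.-integrable setT (EFin \o phi).
    apply: measurable_bounded_integrable => //.
    + have PT : (P setT < +oo)%E by rewrite probability_setT ltry.
      exact: PT.
    + exact: (mhoelder _ hphi).
    + exists C; split; first exact: num_real.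
      by move=> D CD x _; apply: le_trans (ltW CD).
  have mNs g : measurable_fun setT g -> (forall x, 0 <= g x)%E ->
    measurable_fun setT (fun y => N n g (iter n left_shift y)).
    move=> mg g0; apply: (measurableT_comp (mN n g mg g0)).
    exact: measurable_iter_left_shift.
  (* Compatibility for nonnegative functions, where [P] is the kernel of index n+r at [z]. *)
  have NN g : measurable_fun setT g -> (forall x, 0 <= g x)%E ->
      (\int[P]_y N n g (iter n left_shift y) = \int[P]_y g y)%E.
    move=> mg g0; rewrite !PN//; last 2 first.
    + exact: mNs.
    + by move=> x; exact: N0.
    exact: (normalized_ruelle_compat mf f0 f_int mA AM).
  have iN g : measurable_fun setT g -> (forall x, 0 <= g x)%E ->
      P.-integrable setT g ->
      P.-integrable setT (fun y => N n g (iter n left_shift y)).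
    move=> mg g0 /integrableP[_ ig]; apply/integrableP; split; first exact: mNs.
    (* By nonnegativity the norm is the integral itself, which [NN] identifies with the finite
       integral of [g]. *)
    under eq_integral do rewrite gee0_abs ?N0//.
    rewrite NN//; apply: le_lt_trans ig; apply: ge0_le_integral => //.
    + exact: measurableT_comp.
    + by move=> x _; rewrite lee_abs.
  rewrite integralB//; last 2 first.
  + by apply: iN => //; exact: integrable_funepos.
  + by apply: iN => //; exact: integrable_funeneg.
  by rewrite !NN// [LHS]integralE.
Qed.
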